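(* Let $q$ be a prime power, $n,m,k$ positive integers, and let $\mathcal{C}\subseteq\mathcal{L}_{n,q}[X_1,\dots,X_m]$ be a nondegenerate $k$-dimensional $\mathbb{F}_{q^n}$-linear rank-metric code with $d_{\mathrm{rk}}(\mathcal{C})>1$. Let $\mathcal{G}$ be an $\mathbb{F}_{q^n}$-basis of $\mathcal{C}$ and $\mathcal{G}'$ an $\mathbb{F}_{q^n}$-basis of $\mathcal{C}^\perp$ (which has dimension $nm-k$). Then $U_{\mathcal{G}'}\subseteq\mathbb{F}_{q^n}^{nm-k}$ is $\mathrm{GL}(nm-k,q^n)$-equivalent to the Delsarte dual of $U_{\mathcal{G}}\subseteq\mathbb{F}_{q^n}^k$.
   Context: $\mathcal{L}_{n,q}[X_1,\dots,X_m]$ is the $\mathbb{F}_{q^n}$-vector space with basis $\{X_i^{q^j}:1\le i\le m,\ 0\le j\le n-1\}$; each element $f$ defines an $\mathbb{F}_q$-linear map $\mathbb{F}_{q^n}^m\to\mathbb{F}_{q^n}$ whose $\mathbb{F}_q$-rank is $\mathrm{rk}(f)$. A code is an $\mathbb{F}_{q^n}$-subspace $\mathcal{C}$, $d_{\mathrm{rk}}(\mathcal{C})=\min\{\mathrm{rk}(f):0\ne f\in\mathcal{C}\}$. For $f=\sum f_{i,j}X_i^{q^j}$, $g=\sum g_{i,j}X_i^{q^j}$ set $f\star g=\sum f_{i,j}g_{i,j}$ and $\mathcal{C}^\perp=\{f:f\star g=0\ \forall g\in\mathcal{C}\}$. For a basis $\mathcal{G}=(g_1,\dots,g_k)$, $U_{\mathcal{G}}=\{(g_1(x),\dots,g_k(x)):x\in\mathbb{F}_{q^n}^m\}$;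 $\mathcal{C}$ is nondegenerate if $\dim_{\mathbb{F}_q}U_{\mathcal{G}}=nm$. Two $\mathbb{F}_q$-subspaces of $\mathbb{F}_{q^n}^t$ are $\mathrm{GL}(t,q^n)$-equivalent if one is the image of the other under an element of $\mathrm{GL}(t,q^n)$. Delsarte dual: let $U$ be an $M$-dimensional $\mathbb{F}_q$-subspace of $V=\mathbb{F}_{q^n}^k$ with $M>k$ and $\langle U\rangle_{\mathbb{F}_{q^n}}=V$. There exist an $M$-dimensional $\mathbb{F}_{q^n}$-space $Z$, an $M$-dimensional $\mathbb{F}_q$-subspace $W$ of $Z$ with $\langle W\rangle_{\mathbb{F}_{q^n}}=Z$, and an $(M-k)$-dimensional $\mathbb{F}_{q^n}$-subspace $\Gamma$ of $Z$ with $W\cap\Gamma=\{0\}$, such that an $\mathbb{F}_{q^n}$-isomorphism $Z/\Gamma\to V$ maps $(W+\Gamma)/\Gamma$ onto $U$. Take a nondegenerate $\mathbb{F}_q$-bilinear form $\beta'$ on $W$, extend it $\mathbb{F}_{q^n}$-bilinearly to a nondegenerate form $\beta$ on $Z$, and let $\Gamma^\perp$ be the orthogonal complement of $\Gamma$ with respect to $\beta$ (a $k$-dimensional $\mathbb{F}_{q^n}$-subspace). The Delsarte dual of $U$ is the $M$-dimensional $\mathbb{F}_q$-subspace $(W+\Gamma^\perp)/\Gamma^\perp$ of $Z/\Gamma^\perp\cong\mathbb{F}_{q^n}^{M-k}$; up to equivalence it does not depend on the choices made. *)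

(* Defs.v *)
From HB Require Import structures.
From mathcomp Require Import all_boot all_order all_algebra all_field.

Set Implicit Arguments.
Unset Strict Implicit.
Unset Printing Implicit Defensive.

Import GRing.Theory.
Local Open Scope ring_scope.

(** * Restriction of scalars

   Throughout, [F] plays the role of F_q and [L] that of F_{q^n}.  An L-space
   [Z] is an F-space [resF Z] on the same carrier, so that the F-subspaces of
   [Z] are the elements of [{vspace resF Z}] and its L-subspaces those of
   [{vspace Z}]. *)

Section RestrictScalars.
Variables (F : fieldType) (L : fieldExtType F).

Definition resF (Z : vectType L) : Type := Z.

Section Instances.
Variable Z : vectType L.

HB.instance Definition _ := GRing.Zmodule.on (resF Z).

Definition resF_scale (a : F) (u : resF Z) : resF Z := a%:A *: (u : Z).

Fact resF_scaleA a b u : resF_scale a (resF_scale b u) = resF_scale (a * b) u.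
Proof. by rewrite /resF_scale scalerA -[a%:A * _]/(in_alg L a * in_alg L b) -rmorphM. Qed.

Fact resF_scale1 : left_id 1 resF_scale.
Proof. by move=> u; rewrite /resF_scale !scale1r. Qed.

Fact resF_scaleDr : right_distributive resF_scale +%R.
Proof. by move=> a u v; apply: scalerDr. Qed.

Fact resF_scaleDl v : {morph resF_scale^~ v : a b / a + b}.
Proof. by move=> a b; rewrite /resF_scale !scalerDl. Qed.

HB.instance Definition _ := GRing.Zmodule_isLmodule.Build F (resF Z)
  resF_scaleA resF_scale1 resF_scaleDr resF_scaleDl.

Lemma resF_scaleE a (u : Z) : a *: (u : resF Z) = a%:A *: u.
Proof. by []. Qed.

Fact resF_vectMixin : Lmodule_hasFinDim F (resF Z).
Proof.
pose bF := vbasis {:L}; pose bZ := vbasis {:Z}.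
have coordF (x : L) := coord_vbasis (memvf x).
pose v2r (x : resF Z) :=
  mxvec (\matrix_(i < \dim {:Z}, j < \dim {:L}) coord bF j (coord bZ i (x : Z))).
have v2r_lin : linear v2r.
  move=> a x y; rewrite -linearP; congr mxvec; apply/matrixP=> i j.
  by rewrite !mxE linearP /= mulr_algl linearP.
pose r2v (r : 'rV[F]_(\dim {:Z} * \dim {:L})) : resF Z :=
  \sum_(i < \dim {:Z}) ((\sum_(j < \dim {:L}) vec_mx r i j *: bF`_j) *: bZ`_i : Z).
have v2rK : cancel v2r r2v.
  move=> x; transitivity (\sum_(i < \dim {:Z}) coord bZ i (x : Z) *: bZ`_i).
    apply: eq_bigr => i _; rewrite mxvecK; congr (@GRing.scale L Z _ _).
    by rewrite [RHS]coordF; apply: eq_bigr => j _; rewrite mxE.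
  by rewrite -coord_vbasis ?memvf.
exists (\dim {:Z} * \dim {:L})%N, v2r => //; exists r2v => // r.
apply: (canLR vec_mxK); apply/matrixP=> i j; rewrite mxE.
by rewrite !coord_sum_free ?(basis_free (vbasisP _)).
Qed.

HB.instance Definition _ := resF_vectMixin.

(* The L-span of an F-subspace. *)
Definition Lspan (W : {vspace resF Z}) : {vspace Z} :=
  <<(vbasis W : seq (resF Z)) : seq Z>>%VS.

Lemma Lspan_sub (W : {vspace resF Z}) (S : {vspace Z}) :
  {subset W <= S} <-> (Lspan W <= S)%VS.
Proof.
split=> [sWS | /subvP sWS w].
  by apply/span_subvP=> w Ww; apply/sWS/vbasis_mem.
move/coord_vbasis->; apply: memv_suml => i _; rewrite resF_scaleE memvZ //.
by apply: sWS; rewrite memv_span // mem_nth // size_tuple.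
Qed.

End Instances.

(* An L-linear map, seen as an F-linear map. *)
Section Hom.
Variables (Z1 Z2 : vectType L) (f : 'Hom(Z1, Z2)).

Definition res_fun (u : resF Z1) : resF Z2 := f (u : Z1).

Fact res_fun_linear : linear res_fun.
Proof. by move=> a u v; rewrite /res_fun linearP. Qed.

HB.instance Definition _ :=
  GRing.isLinear.Build F (resF Z1) (resF Z2) _ res_fun res_fun_linear.

Definition resHom : 'Hom(resF Z1, resF Z2) := linfun res_fun.

Lemma resHomE (u : Z1) : resHom u = f u.
Proof. by rewrite lfunE. Qed.

End Hom.

(* Row vectors: [A] acts by [v |-> v *m A]. *)
Definition GLequiv (t : nat) (U1 U2 : {vspace resF 'rV[L]_t}) : Prop :=
  exists2 A : 'M[L]_t, A \in unitmx & (resHom (linfun (mulmxr A)) @: U1)%VS = U2.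

End RestrictScalars.

(** * Quotient spaces

   [Z / Gamma] is carried by a complement of [Gamma], the canonical projection
   being the projection along [Gamma]. *)

Section Quotient.
Variables (K : fieldType) (Z : vectType K) (Gamma : {vspace Z}).

Definition quotv := subvs_of (Gamma^C)%VS.
HB.instance Definition _ := Vector.on quotv.

Definition quotv_proj : 'Hom(Z, quotv) :=
  linfun (vsproj (Gamma^C)%VS \o daddv_pi (Gamma^C)%VS Gamma).

Lemma quotv_proj_ker : lker quotv_proj = Gamma.
Proof.
have dGC : ((Gamma^C) :&: Gamma = 0)%VS by rewrite capvC capv_compl.
have sumG z : z \in (Gamma^C + Gamma)%VS by rewrite addvC addv_complf memvf.
apply/vspaceP=> z; rewrite memv_ker lfunE /=; apply/eqP/idP=> [z0 | Gz].
  rewrite -(daddv_pi_add dGC (sumG z)).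
  have -> : daddv_pi (Gamma^C)%VS Gamma z = 0.
    by rewrite -(vsprojK (memv_pi _ _ z)) z0 linear0.
  by rewrite add0r memv_pi.
have dGC' : (Gamma :&: (Gamma^C) = 0)%VS by rewrite capv_compl.
have := daddv_pi_add dGC (sumG z); rewrite (daddv_pi_id dGC' Gz).
by move/eqP; rewrite -subr_eq0 addrK => /eqP->; rewrite linear0.
Qed.

Lemma quotv_proj_img : limg quotv_proj = fullv.
Proof.
have dGC : ((Gamma^C) :&: Gamma = 0)%VS by rewrite capvC capv_compl.
apply/eqP; rewrite eqEsubv subvf; apply/subvP=> u _.
apply/memv_imgP; exists (vsval u); first exact: memvf.
by rewrite lfunE /= daddv_pi_id ?subvsP // vsvalK.
Qed.

End Quotient.

(** * Bilinear forms *)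

Section Bilinear.
Variables (K : fieldType) (Z : vectType K) (beta : {biscalar Z}).

Definition nondegenerate_form : Prop :=
  (forall u, (forall v, beta u v = 0) -> u = 0) /\
  (forall v, (forall u, beta u v = 0) -> v = 0).

Definition perpv (V : {vspace Z}) : {vspace Z} :=
  (\bigcap_(i < \dim V) lker (linfun (applyr beta (vbasis V)`_i : Z -> K^o)))%VS.

Lemma perpvP (V : {vspace Z}) u :
  reflect {in V, forall v, beta u v = 0} (u \in perpv V).
Proof.
rewrite memvE; apply: (iffP subv_bigcapP) => [uP v /coord_vbasis-> | uP i _].
  rewrite linear_sumr big1 // => i _; rewrite linearZr /=.
  by have := uP i isT; rewrite -memvE memv_ker lfunE /= => /eqP->; rewrite mulr0.
rewrite -memvE memv_ker lfunE /=; apply/eqP/uP.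
by rewrite vbasis_mem // mem_nth // size_tuple.
Qed.

End Bilinear.

(** * The Delsarte dual *)

Section DelsarteDual.
Variables (F : fieldType) (L : fieldExtType F).

(* [is_Delsarte_dual U D]: some admissible choice of Z, W, Gamma, beta', beta
   (and of coordinates on [Z / Gamma^perp]) produces [D] as Delsarte dual of
   the [M]-dimensional F-subspace [U] of L^k. *)
Variant is_Delsarte_dual (k M : nat)
    (U : {vspace resF 'rV[L]_k}) (D : {vspace resF 'rV[L]_(M - k)}) : Prop :=
  IsDelsarteDual
    (Z : vectType L) (W : {vspace resF Z}) (Gamma : {vspace Z})
    (phi : 'Hom(quotv Gamma, 'rV[L]_k))
    (beta' : {biscalar (subvs_of W)}) (beta : {biscalar Z})
    (psi : 'Hom(quotv (perpv beta Gamma), 'rV[L]_(M - k)))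
  of (k < M)%N & \dim U = M & Lspan U = fullv
  & \dim {:Z} = M & \dim W = M & Lspan W = fullv
  & \dim Gamma = (M - k)%N
  & (forall w : Z, w \in W -> w \in Gamma -> w = 0)
  & bijective phi
  & (resHom (phi \o quotv_proj Gamma)%VF @: W)%VS = U
  & nondegenerate_form beta'
  & (forall u v : subvs_of W, beta (vsval u : Z) (vsval v : Z) = (beta' u v)%:A)
  & nondegenerate_form beta
  & bijective psi
  & (resHom (psi \o quotv_proj (perpv beta Gamma))%VF @: W)%VS = D.

End DelsarteDual.

(** * Rank-metric codes

   An element of L_{n,q}[X_1, ..., X_m] is represented by its coordinates in
   the basis X_i^(q^j): the matrix [f : 'M[L]_(m, n)] stands for the polynomial
   with coefficient [f i j] on X_i^(q^j), where q = #|F|. *)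

Section Codes.
Variables (F : finFieldType) (L : fieldExtType F) (n m : nat).
Implicit Types (f g : 'M[L]_(m, n)) (C : {vspace 'M[L]_(m, n)}).

Definition qpoly_eval f (x : resF 'rV[L]_m) : L :=
  \sum_(i < m) \sum_(j < n) f i j * (x : 'rV[L]_m) 0 i ^+ (#|F| ^ j).

Fact qpoly_eval_linear f : linear (qpoly_eval f).
Proof.
have [p pr_p pF] := finPcharP F.
have pL : p \in [pchar L] by rewrite (pchar_lalg L).
have FrD (x y : L) j : (x + y) ^+ (#|F| ^ j) = x ^+ (#|F| ^ j) + y ^+ (#|F| ^ j).
  apply: exprDn_pchar; rewrite (eq_pnat _ (pcharf_eq pL)) pnatX.
  by rewrite (card_primeChar pF) pnatX pnat_id.
have FrZ (a : F) j : a ^+ (#|F| ^ j) = a.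
  by elim: j => [|j IHj]; rewrite ?expr1 // expnSr exprM IHj expf_card.
move=> a x y; rewrite /qpoly_eval scaler_sumr -big_split /=.
apply: eq_bigr => i _; rewrite scaler_sumr -big_split /=.
apply: eq_bigr => j _; rewrite resF_scaleE !mxE FrD exprMn mulrDr; congr (_ + _).
by rewrite exprZn expr1n FrZ mulrCA mulr_algl.
Qed.

HB.instance Definition _ f :=
  GRing.isLinear.Build F (resF 'rV[L]_m) L _ (qpoly_eval f) (qpoly_eval_linear f).

Definition rk f : nat := \dim (limg (linfun (qpoly_eval f))).

(* [d] is d_rk(C), the minimum rank of a nonzero codeword. *)
Definition is_min_distance C (d : nat) : Prop :=
  (exists f, [/\ f \in C, f != 0 & rk f = d]) /\
  (forall f, f \in C -> f != 0 -> (d <= rk f)%N).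

Definition star f g : L := \sum_(i < m) \sum_(j < n) f i j * g i j.

Fact star_is_bilinear :
  bilinear_for (GRing.Scale.Law.clone _ _ *%R _) (GRing.Scale.Law.clone _ _ *%R _) star.
Proof.
split=> [g|f] a u v; rewrite /star /= mulr_sumr -big_split; apply: eq_bigr => i _;
  rewrite mulr_sumr -big_split; apply: eq_bigr => j _; rewrite !mxE /=.
  by rewrite mulrDl mulrA.
by rewrite mulrDr mulrCA.
Qed.

HB.instance Definition _ :=
  bilinear_isBilinear.Build L 'M[L]_(m, n) 'M[L]_(m, n) L _ _ star star_is_bilinear.

Definition dual_code C : {vspace 'M[L]_(m, n)} := perpv star C.

Lemma dual_codeP C f : reflect {in C, forall g, star f g = 0} (f \in dual_code C).
Proof. exact: perpvP. Qed.

Section System.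
Variables (k : nat) (G : k.-tuple 'M[L]_(m, n)).

Definition system_fun (x : resF 'rV[L]_m) : resF 'rV[L]_k :=
  \row_(s < k) qpoly_eval (tnth G s) x.

Fact system_fun_linear : linear system_fun.
Proof.
move=> a x y; rewrite /system_fun; apply/rowP=> s.
by rewrite resF_scaleE !mxE linearP mulr_algl.
Qed.

HB.instance Definition _ :=
  GRing.isLinear.Build F (resF 'rV[L]_m) (resF 'rV[L]_k) _ system_fun system_fun_linear.

(* U_G *)
Definition system : {vspace resF 'rV[L]_k} := limg (linfun system_fun).

End System.

(* The dimension of U_G does not depend on the basis G of C. *)
Definition nondegenerate_code C : Prop :=
  exists2 G : (\dim C).-tuple 'M[L]_(m, n),
    basis_of C G & \dim (system G) = (n * m)%N.

End Codes.

Arguments is_Delsarte_dual {F L k} M U D.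

(* Main.v *)
Require Import Defs.
From HB Require Import structures.
From mathcomp Require Import all_boot all_order all_algebra all_field.
Set Implicit Arguments.
Unset Strict Implicit.
Unset Printing Implicit Defensive.
Import GRing.Theory.
Local Open Scope ring_scope.

(** Let [W0] be the F_q-space of the matrices [moore x = (x_i ^ (q^j))_(i,j)] in
   [Z0 = 'M[L]_(m, n)].  Since [f x = star f (moore x)], the system [U_G] is the
   image of [W0] under the L-linear surjection [z |-> (star g_s z)_s], whose
   kernel is the dual code of [C].  The form [star] restricts on [W0] to the trace form
   [(x, y) |-> Tr (sum_i x_i y_i)], so [(Z0, W0, C^perp, star)] is an admissible
   choice in the definition of the Delsarte dual, and it produces [U_G'].
   For an arbitrary choice [(Z, W, Gamma, beta)], the isomorphism [T : Z -> Z0]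
   compatible with the projections to [L^k] and the [star]-adjoint [N] given by
   [star (N z) (T z') = beta z z'] are such that [N] maps [W] onto [W0] and [Gamma^perp]
   onto [C]; the key point is that [W0] is its own F_q-dual lattice for [star]. *)

(** * Linear maps over a single field *)

Section LinearAlgebra.
Variable K : fieldType.

(** The map is [g \o f^-1]: a section of [f] is defined up to [lker f], which [g] kills; exchanging
    [f] and [g] gives the inverse. This identifies two models of one quotient space. *)
Lemma lfun_factor (aT rT1 rT2 : vectType K) (f : 'Hom(aT, rT1)) (g : 'Hom(aT, rT2)) :
  limg f = fullv -> limg g = fullv -> lker f = lker g ->
  exists2 h : 'Hom(rT1, rT2), bijective h & forall z, h (f z) = g z.
Proof.
move=> fT gT kfg; exists (g \o f^-1)%VF; last first.
  move=> z; rewrite lfunE /=; apply/eqP; rewrite -subr_eq0 -linearB -memv_ker -kfg.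
  by rewrite memv_ker linearB /= limg_lfunVK ?subrr ?fT ?memvf.
exists (f \o g^-1)%VF => [y|y]; rewrite !lfunE /=.
  have yf : y \in limg f by rewrite fT memvf.
  rewrite -[RHS](limg_lfunVK yf); apply/eqP; rewrite -subr_eq0 -linearB.
  rewrite -memv_ker kfg memv_ker linearB /= limg_lfunVK ?subrr ?gT ?memvf //.
have yg : y \in limg g by rewrite gT memvf.
rewrite -[RHS](limg_lfunVK yg); apply/eqP; rewrite -subr_eq0 -linearB.
by rewrite -memv_ker -kfg memv_ker linearB /= limg_lfunVK ?subrr ?fT ?memvf.
Qed.

Lemma lker_surj_eq0 (aT rT : vectType K) (f : 'Hom(aT, rT)) :
  limg f = fullv -> \dim {:aT} = \dim {:rT} -> lker f == 0%VS.
Proof.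
move=> fT dimE; have := limg_ker_dim f fullv.
by rewrite fT dimE capfv => /eqP; rewrite -[X in _ == X]add0n eqn_add2r dimv_eq0.
Qed.

Lemma bijective_limg (aT rT : vectType K) (f : 'Hom(aT, rT)) :
  bijective f -> limg f = fullv.
Proof.
case=> g _ gK; apply/eqP; rewrite eqEsubv subvf; apply/subvP=> y _.
by rewrite -[y]gK memv_img ?memvf.
Qed.

Lemma bijective_lker (aT rT : vectType K) (f : 'Hom(aT, rT)) :
  bijective f -> lker f == 0%VS.
Proof. by case=> g fK _; apply/lker0P; apply: can_inj fK. Qed.

Lemma lfun_rV_mulmx t (h : 'Hom('rV[K]_t, 'rV[K]_t)) :
  bijective h -> exists2 A : 'M[K]_t, A \in unitmx & forall v, h v = v *m A.
Proof.
move=> /bijective_lker h0; exists (lin1_mx h) => [|v]; last by rewrite mul_rV_lin1.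
rewrite -row_free_unit; apply: inj_row_free => v; rewrite mul_rV_lin1 => hv.
by apply/eqP; rewrite -memv0 -(eqP h0) memv_ker hv.
Qed.

End LinearAlgebra.

(** * L-linear maps and F-subspaces that span over L *)

Section Restriction.
Variables (F : fieldType) (L : fieldExtType F).

(** [lker (f - g)] is an L-subspace, so it contains the L-span of [W] as soon as it contains [W]. *)
Lemma Lspan_full_eq (Z V : vectType L) (W : {vspace resF Z}) (f g : 'Hom(Z, V)) :
  Lspan W = fullv -> (forall w : Z, w \in W -> f w = g w) -> f = g.
Proof.
move=> WT fg; have : (Lspan W <= lker (f - g))%VS.
  apply/Lspan_sub => w Ww; change ((w : Z) \in lker (f - g)).
  by rewrite memv_ker !lfunE /= lfunE /= fg // subrr.
rewrite WT => /subvP sub; apply/lfunP=> z; apply/eqP; rewrite -subr_eq0.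
by have := sub z (memvf z); rewrite memv_ker !lfunE /= lfunE.
Qed.

(** Equality of the dimensions makes an F-basis of [W] an L-basis of [Z], on which an L-linear map
    can be prescribed freely. *)
Lemma Lspan_extend (Z V : vectType L) (W : {vspace resF Z}) (h : 'Hom(resF Z, resF V)) :
  Lspan W = fullv -> \dim W = \dim {:Z} ->
  exists f : 'Hom(Z, V), forall w : Z, w \in W -> f w = h w.
Proof.
move=> WT dW; pose b : (\dim W).-tuple Z := vbasis W.
have bT : basis_of fullv b.
  by rewrite basisEdim size_tuple -[X in (_ <= X)%N]dW leqnn andbT -WT.
pose f0 (z : Z) : V := \sum_(i < \dim W) coord b i z *: (h b`_i : V).
have f0lin : linear f0.
  move=> a x y; rewrite /f0 scaler_sumr -big_split; apply: eq_bigr => i _ /=.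
  by rewrite linearP scalerDl scalerA.
pose f0L : {linear Z -> V} := HB.pack f0 (GRing.isLinear.Build L Z V _ f0 f0lin).
exists (linfun f0L) => w Ww; rewrite lfunE /= /f0.
have {2}-> := coord_vbasis Ww; rewrite linear_sum; apply: eq_bigr => i _ /=.
have -> : coord b i w = (coord (vbasis W) i (w : resF Z))%:A.
  have {1}-> := coord_vbasis Ww.
  rewrite (eq_bigr (fun j => (coord (vbasis W) j (w : resF Z))%:A *: (b`_j : Z))) //.
  by rewrite coord_sum_free // (basis_free bT).
by rewrite linearZ.
Qed.

End Restriction.

(** * The q-Frobenius on L and the zeros of q-polynomials *)

Section FrobeniusFacts.
Variables (F : finFieldType) (L : fieldExtType F).
Local Notation q := #|F|.

Lemma card_ext : #|FinFieldExtType L| = (q ^ \dim {:L})%N.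
Proof.
rewrite -(@card_vspacef F (FinFieldExtType L) (Vector.class L)).
exact: (@card_vspace F (FinFieldExtType L) (Vector.class L)).
Qed.

Lemma expr_card_ext (x : L) : x ^+ (q ^ \dim {:L}) = x.
Proof.
have := expf_card (x : FinFieldExtType L).
by rewrite card_ext.
Qed.

(** Over F, ['X^q - 'X] is the product of the ['X - a], so all its roots in L come from F. *)
Lemma fixed_card_mem1 (x : L) : x ^+ q = x -> x \in 1%VS.
Proof.
move=> xq; have : root (map_poly (in_alg L) ('X^q - 'X)) x.
  by rewrite rmorphB /= map_polyXn map_polyX rootE !hornerE xq subrr.
rewrite finField_genPoly rmorph_prod /= rootE horner_prod prodf_seq_eq0.
case/hasP=> a _; rewrite rmorphB /= map_polyX map_polyC !hornerE subr_eq0 => /eqP->.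
by apply/vlineP; exists a.
Qed.

Lemma mem1_fixed_card (x : L) : x \in 1%VS -> x ^+ q = x.
Proof.
by case/vlineP=> a ->; rewrite exprZn expr1n expf_card.
Qed.

Lemma exprD_card (x y : L) : (x + y) ^+ q = x ^+ q + y ^+ q.
Proof.
have [p pr_p pF] := finPcharP F.
have pL : p \in [pchar L] by rewrite (pchar_lalg L).
apply: exprDn_pchar; rewrite (eq_pnat _ (pcharf_eq pL)).
by rewrite (card_primeChar pF) pnatX pnat_id.
Qed.

Lemma expr_sum_card I (r : seq I) (P : pred I) (f : I -> L) :
  (\sum_(i <- r | P i) f i) ^+ q = \sum_(i <- r | P i) f i ^+ q.
Proof.
apply: (big_morph (fun x : L => x ^+ q) exprD_card).
by rewrite expr0n; case: #|F| (finNzRing_gt1 F).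
Qed.

(** If nonzero, the polynomial [p] would have degree at most q^(n-1) and all q^[L:F] elements of L
    as roots. *)
Lemma qpoly_roots_eq0 n (c : 'I_n -> L) : (n <= \dim {:L})%N ->
  (forall x : L, \sum_(j < n) c j * x ^+ (q ^ j) = 0) -> forall j, c j = 0.
Proof.
move=> le_n c0 j0; have q1 := finNzRing_gt1 F.
pose p : {poly L} := \sum_(j < n) c j *: 'X^(q ^ j).
suff p0 : p = 0.
  have : p`_(q ^ j0) = c j0.
    rewrite coef_sum (bigD1 j0) //= big1 ?addr0 => [|j jj0].
      by rewrite coefZ coefXn eqxx mulr1.
    by rewrite coefZ coefXn eqn_exp2l // (inj_eq val_inj) eq_sym (negPf jj0) mulr0.
  by rewrite p0 coef0.
apply/eqP/negPn/negP => p_neq0.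
pose rs : seq L := enum (FinFieldExtType L).
have rs_root : all (root p) rs.
  apply/allP=> x _; rewrite rootE horner_sum -[X in _ == X](c0 x); apply/eqP.
  by apply: eq_bigr => j _; rewrite hornerZ hornerXn.
have := max_poly_roots p_neq0 rs_root (enum_uniq _).
have -> : size rs = (q ^ \dim {:L})%N.
  by rewrite /rs -(cardE (FinFieldExtType L)) card_ext.
apply/negP; rewrite -leqNgt; apply: (leq_trans (size_sum _ _ _)).
apply/bigmax_leqP=> j _; apply: leq_trans (size_scale_leq _ _) _.
by rewrite size_polyXn ltn_exp2l //; apply: leq_trans le_n.
Qed.

End FrobeniusFacts.

(** * Dimensions of matrix spaces and of restrictions of scalars *)

Lemma dim_fullv_matrix (K : fieldType) a b : \dim {:'M[K]_(a, b)} = (a * b)%N.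
Proof. by rewrite dimvf dim_matrix. Qed.

Lemma dim_resF (F : fieldType) (L : fieldExtType F) (Z : vectType L) :
  \dim {:resF Z} = (\dim {:Z} * \dim {:L})%N.
Proof.
pose bL := vbasis {:L}; pose bZ := vbasis {:Z}.
pose h0 (A : 'M[F]_(\dim {:Z}, \dim {:L})) : resF Z :=
  \sum_(i < \dim {:Z}) ((\sum_(j < \dim {:L}) A i j *: bL`_j) *: bZ`_i : Z).
have h0lin : linear h0.
  move=> a A B; rewrite /h0 scaler_sumr -big_split; apply: eq_bigr => i _ /=.
  have -> : \sum_(j < \dim {:L}) (a *: A + B) i j *: bL`_j =
      a *: (\sum_(j < \dim {:L}) A i j *: bL`_j) + \sum_(j < \dim {:L}) B i j *: bL`_j.
    rewrite scaler_sumr -big_split; apply: eq_bigr => j _ /=.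
    by rewrite !mxE scalerDl scalerA.
  by rewrite -mulr_algl scalerDl -scalerA.
pose h1 : {linear 'M[F]_(_, _) -> resF Z} :=
  HB.pack h0 (GRing.isLinear.Build F 'M[F]_(\dim {:Z}, \dim {:L}) (resF Z) _ h0 h0lin).
pose h := linfun h1.
have h_inj : lker h == 0%VS.
  apply/lker0P => A B; rewrite !lfunE /= => hAB; apply/matrixP=> i j.
  have := congr1 (coord bZ i : Z -> L) hAB.
  rewrite /h0 !coord_sum_free ?(basis_free (vbasisP _)) // => /(congr1 (coord bL j)).
  by rewrite !coord_sum_free ?(basis_free (vbasisP _)).
have hT : limg h = fullv.
  apply/eqP; rewrite eqEsubv subvf; apply/subvP=> z _.
  apply/memv_imgP; exists (\matrix_(i, j) coord bL j (coord bZ i (z : Z))); first exact: memvf.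
  rewrite lfunE /= /h0 [LHS](coord_vbasis (memvf (z : Z))); apply: eq_bigr => i _.
  congr (@GRing.scale L Z _ _); rewrite {1}(coord_vbasis (memvf (coord bZ i (z : Z)))).
  by apply: eq_bigr => j _; rewrite mxE.
by rewrite -hT limg_dim_eq ?(eqP h_inj) ?capv0 // dim_fullv_matrix.
Qed.

(** * The form [star] and dual codes *)

Section Codes.
Variables (F : finFieldType) (L : fieldExtType F) (n m : nat).
Local Notation q := #|F|.
Local Notation Z0 := 'M[L]_(m, n).
Implicit Types (f g z : Z0) (C : {vspace Z0}).

Lemma starC f g : star f g = star g f.
Proof. by apply: eq_bigr => i _; apply: eq_bigr => j _; rewrite mulrC. Qed.

Lemma star_eq0 f : (forall g, star f g = 0) -> f = 0.
Proof.
move=> f0; apply/matrixP=> i j; rewrite -[LHS]mulr1 mxE -(f0 (delta_mx i j)).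
rewrite /star (bigD1 i) //= (bigD1 j) //= !mxE !eqxx !big1 ?addr0 //.
  by move=> i' i'i; rewrite big1 // => j' _; rewrite mxE (negPf i'i) mulr0.
by move=> j' j'j; rewrite mxE (negPf j'j) andbF mulr0.
Qed.

Lemma star_nondegenerate : nondegenerate_form (@star F L n m).
Proof.
split=> [f f0|g g0]; apply: star_eq0 => h; first exact: f0.
by rewrite starC; apply: g0.
Qed.

Section Evaluation.
Variables (k : nat) (G : k.-tuple Z0).

Definition star_row z : 'rV[L]_k := \row_(s < k) star (tnth G s) z.

Fact star_row_linear : linear star_row.
Proof. by move=> a x y; apply/rowP=> s; rewrite !mxE linearPr. Qed.

HB.instance Definition _ :=
  GRing.isLinear.Build L Z0 'rV[L]_k _ star_row star_row_linear.

Definition star_hom : 'Hom(Z0, 'rV[L]_k) := linfun star_row.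

Lemma star_homE z : star_hom z = star_row z. Proof. exact: lfunE. Qed.

Lemma lker_star_hom C : basis_of C G -> lker star_hom = dual_code C.
Proof.
move=> bG; apply/vspaceP=> z; rewrite memv_ker star_homE.
apply/eqP/dual_codeP => [z0 g Cg|z0].
  rewrite (coord_basis bG Cg) linear_sumr big1 // => s _.
  rewrite linearZr /= starC -tnth_nth.
  by move/rowP/(_ s): z0; rewrite !mxE => ->; rewrite mulr0.
by apply/rowP=> s; rewrite !mxE starC z0 // (basis_mem bG) ?mem_tnth.
Qed.

(** Flattening the codewords into the rows of [M] turns [star_hom] into multiplication by [M^T],
    which has full rank when [G] is free. *)
Lemma limg_star_hom : free G -> limg star_hom = fullv.
Proof.
move=> freeG; pose M := \matrix_(s < k) mxvec (tnth G s).
have M_free : row_free M.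
  apply: inj_row_free => v vM; apply/rowP=> s; rewrite mxE.
  move/freeP: freeG => /(_ (v 0)); apply.
  apply: (can_inj mxvecK); rewrite linear0 -[RHS]vM mulmx_sum_row linear_sum.
  by apply: eq_bigr => j _; rewrite linearZ rowK -tnth_nth.
have M_full : row_full M^T by rewrite /row_full mxrank_tr.
apply/eqP; rewrite eqEsubv subvf; apply/subvP=> v _.
have /submxP[w wM] := submx_full v M_full.
apply/memv_imgP; exists (vec_mx w); first exact: memvf.
rewrite star_homE wM; apply/rowP=> s; rewrite !mxE -{1}[w]vec_mxK.
rewrite (reindex _ (curry_mxvec_bij _ _)) /= [RHS]pair_bigA.
apply: eq_bigr => -[i j] _ /=.
by rewrite !mxE; apply: etrans (congr2 _ (mxvecE _ i j) (mxvecE _ i j)) _; rewrite mxE mulrC.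
Qed.

End Evaluation.

Lemma dim_dual_code C : \dim (dual_code C) = (m * n - \dim C)%N.
Proof.
have bC := vbasisP C; rewrite -(lker_star_hom bC).
have := limg_ker_dim (star_hom (vbasis C)) fullv.
rewrite capfv limg_star_hom ?(basis_free bC) // !dim_fullv_matrix mul1n => <-.
by rewrite addnK.
Qed.

Lemma dual_codeK C : dual_code (dual_code C) = C.
Proof.
apply/esym/eqP; rewrite eqEdim !dim_dual_code subKn; last first.
  by rewrite -(dim_fullv_matrix L) dimvS ?subvf.
rewrite leqnn andbT; apply/subvP=> f Cf; apply/dual_codeP => g /dual_codeP gC.
by rewrite starC gC.
Qed.

(** * Moore matrices and the self-dual F-space [mooreV] *)

Definition moore (x : resF 'rV[L]_m) : resF Z0 :=
  \matrix_(i < m, j < n) (x : 'rV[L]_m) 0 i ^+ (q ^ j).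

Lemma qpoly_evalE f x : qpoly_eval f x = star f (moore x).
Proof. by apply: eq_bigr => i _; apply: eq_bigr => j _; rewrite mxE. Qed.

Fact moore_linear : linear moore.
Proof.
move=> a x y; apply/matrixP=> i j.
have mooreE u : moore u i j = qpoly_eval (delta_mx i j) u.
  rewrite /qpoly_eval (bigD1 i) //= (bigD1 j) //= !mxE !eqxx mul1r !big1 ?addr0 //.
    by move=> i' i'i; rewrite big1 // => j' _; rewrite mxE (negPf i'i) mul0r.
  by move=> j' j'j; rewrite mxE (negPf j'j) andbF mul0r.
transitivity ((a%:A *: (moore x : Z0) + moore y) i j); last by [].
by rewrite [RHS]mxE [X in _ = X + _]mxE mulr_algl mooreE linearP /= -!mooreE.
Qed.

HB.instance Definition _ :=
  GRing.isLinear.Build F (resF 'rV[L]_m) (resF Z0) _ moore moore_linear.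

Definition mooreV : {vspace resF Z0} := limg (linfun moore).

Lemma mem_mooreV x : moore x \in mooreV.
Proof. by rewrite -lfunE memv_img ?memvf. Qed.

Lemma mooreVP z : z \in mooreV -> exists x, z = moore x.
Proof. by case/memv_imgP=> x _ ->; exists x; rewrite lfunE. Qed.

Lemma system_funE k (G : k.-tuple Z0) x : system_fun G x = star_hom G (moore x).
Proof. by rewrite star_homE; apply/rowP=> s; rewrite !mxE qpoly_evalE. Qed.

Lemma systemE k (G : k.-tuple Z0) : system G = (resHom (star_hom G) @: mooreV)%VS.
Proof.
rewrite /system /mooreV -limg_comp; congr (limg _); apply/lfunP=> x.
rewrite comp_lfunE resHomE [LHS]lfunE [X in star_hom _ X]lfunE; exact: system_funE.
Qed.

Hypothesis hn : \dim {:L} = n.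

(** Raising to the power q shifts the index cyclically: when j + 1 = n, the wrap to 0 is the
    identity x^(q^n) = x. *)
Lemma exprS_ordS (x : L) (j : 'I_n) : x ^+ (q ^ ordS j) = (x ^+ (q ^ j)) ^+ q.
Proof.
rewrite -exprM -expnSr /=; have [lt_jn|] := ltnP j.+1 n; first by rewrite modn_small.
rewrite leq_eqVlt ltnNge ltn_ord orbF => /eqP jn.
by rewrite -jn modnn expr1 -hn expr_card_ext.
Qed.

(** The q-th power permutes the inner summands cyclically, so the value is fixed by Frobenius. *)
Lemma star_moore_mem1 x y : star (moore x) (moore y) \in 1%VS.
Proof.
apply: fixed_card_mem1; rewrite expr_sum_card; apply: eq_bigr => i _.
rewrite expr_sum_card [RHS](reindex (@ordS n)) /=; last exact: onW_bij (ordS_bij n).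
by apply: eq_bigr => j _; rewrite !mxE !exprS_ordS exprMn.
Qed.

(** Vectors supported on one coordinate isolate a row of [f], which is a q-polynomial in one
    variable vanishing on all of L. *)
Lemma star_moore_eq0 f : (forall y, star f (moore y) = 0) -> f = 0.
Proof.
move=> f0; apply/matrixP=> i j; rewrite mxE; move: j.
apply: (@qpoly_roots_eq0 F L); first by rewrite hn.
move=> x; rewrite -[RHS](f0 (x *: delta_mx 0 i)) /star (bigD1 i) //= [X in _ + X]big1 => [|i' i'i].
  by rewrite addr0; apply: eq_bigr => j _; rewrite !mxE !eqxx mulr1.
rewrite big1 // => j _; rewrite !mxE (negPf i'i) mulr0 expr0n.
by rewrite expn_eq0 (gtn_eqF (ltnW (finNzRing_gt1 F))) mulr0.
Qed.

(* The hypothesis and its q-th power give z_(i,j+1) = z_(i,j)^q, indices j mod n. *)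
Lemma star_mem1_moore z : (0 < n)%N ->
  (forall y, star z (moore y) \in 1%VS) -> z \in mooreV.
Proof.
move=> n_gt0 z1; pose i0 := Ordinal n_gt0.
have zS i j : z i (ordS j) = z i j ^+ q.
  suff /matrixP/(_ i (ordS j)) : \matrix_(i, j) z i (ord_pred j) ^+ q - z = 0.
    by rewrite !mxE ordSK => /eqP; rewrite subr_eq0 => /eqP.
  apply: star_moore_eq0 => y; rewrite linearBl /= -(mem1_fixed_card (z1 y)).
  apply/eqP; rewrite subr_eq0; apply/eqP; rewrite expr_sum_card; apply: eq_bigr => i' _.
  rewrite expr_sum_card [LHS](reindex (@ordS n)) /=; last exact: onW_bij (ordS_bij n).
  by apply: eq_bigr => j' _; rewrite !mxE ordSK exprS_ordS exprMn.
(* The vector is the first column of [z], where the exponent is q^0 = 1; the other columns follow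
   from [zS]. *)
have -> : z = moore (\row_i z i i0); last exact: mem_mooreV.
apply/matrixP=> i [j lt_jn]; rewrite !mxE /=.
elim: j lt_jn => [|j IHj] lt_jn; first by rewrite expr1; congr (z i _); apply: val_inj.
rewrite expnSr exprM -(IHj (ltnW lt_jn)) -zS; congr (z i _); apply: val_inj.
by rewrite /= modn_small.
Qed.

(** A matrix orthogonal to the span is orthogonal to every [moore y], hence zero; biduality then
    makes the span the whole space. *)
Lemma Lspan_mooreV : Lspan mooreV = fullv.
Proof.
rewrite -[Lspan _]dual_codeK; apply/eqP; rewrite eqEsubv subvf; apply/subvP=> f _.
apply/dual_codeP=> g /dual_codeP gS; have -> : g = 0; last exact: linear0r.
apply: star_moore_eq0 => y; apply: gS.
by have /Lspan_sub := subvv (Lspan mooreV); apply; apply: mem_mooreV.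
Qed.

Lemma moore_inj : (0 < n)%N -> injective moore.
Proof.
move=> n_gt0 x y /matrixP xy; apply/rowP=> i.
by have := xy i (Ordinal n_gt0); rewrite !mxE expr1.
Qed.

Lemma dim_mooreV : (0 < n)%N -> \dim mooreV = (n * m)%N.
Proof.
move=> n_gt0; rewrite limg_dim_eq.
  by rewrite dim_resF hn dim_fullv_matrix mul1n mulnC.
apply/eqP; rewrite capfv; apply/lker0P => x y; rewrite !lfunE; exact: moore_inj.
Qed.

(* As a polynomial, [moore x] is Tr(x_1 X_1 + ... + x_m X_m). *)
Lemma rk_moore x : (rk (moore x) <= 1)%N.
Proof.
rewrite -[1%N](dimv1 L) dimvS //; apply/subvP=> _ /memv_imgP[y _ ->].
by rewrite lfunE /= qpoly_evalE star_moore_mem1.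
Qed.

End Codes.

(** * Composition with bijections, equivalence and spans of images *)

Section BijectiveComp.
Variables (K : fieldType) (aT rT1 rT2 : vectType K).
Variables (f : 'Hom(aT, rT1)) (h : 'Hom(rT1, rT2)).
Hypothesis h_bij : bijective h.

Lemma lker_comp_bij : lker (h \o f) = lker f.
Proof.
apply/vspaceP=> z; rewrite !memv_ker comp_lfunE.
by rewrite -(inj_eq (bij_inj h_bij)) linear0.
Qed.

Lemma limg_comp_bij : limg f = fullv -> limg (h \o f) = fullv.
Proof. by move=> fT; rewrite limg_comp fT bijective_limg. Qed.

End BijectiveComp.

Lemma lker_resHom0 (F : fieldType) (L : fieldExtType F) (Z1 Z2 : vectType L)
  (f : 'Hom(Z1, Z2)) : lker f == 0%VS -> lker (resHom f) == 0%VS.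
Proof. by move/lker0P=> f_inj; apply/lker0P => x y; rewrite !resHomE; apply: f_inj. Qed.

Lemma dim_GLequiv (F : fieldType) (L : fieldExtType F) t
    (U1 U2 : {vspace resF 'rV[L]_t}) :
  GLequiv U1 U2 -> \dim U2 = \dim U1.
Proof.
case=> A A_unit <-; rewrite limg_dim_eq //.
have A0 : lker (resHom (linfun (mulmxr A) : 'Hom('rV[L]_t, 'rV[L]_t))) == 0%VS.
  by apply/lker_resHom0/lker0P => x y; rewrite !lfunE; apply: can_inj (mulmxK A_unit) _ _.
by rewrite (eqP A0) capv0.
Qed.

Lemma Lspan_limg (F : fieldType) (L : fieldExtType F) (Z1 Z2 : vectType L)
    (f : 'Hom(Z1, Z2)) (W : {vspace resF Z1}) :
  Lspan W = fullv -> limg f = fullv -> Lspan (resHom f @: W)%VS = fullv.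
Proof.
move=> WT fT; set S := Lspan _; apply/eqP; rewrite eqEsubv subvf -fT.
have : (Lspan W <= f @^-1: S)%VS.
  apply/Lspan_sub => w Ww; change ((w : Z1) \in (f @^-1: S)%VS).
  rewrite -memv_preim -resHomE.
  by have /Lspan_sub := subvv S; apply; apply: memv_img.
rewrite WT => /subvP sub; apply/subvP=> _ /memv_imgP[z _ ->].
by rewrite memv_preim sub ?memvf.
Qed.

(** * The trace form, nondegeneracy, and the Delsarte dual of U_G *)

Section DelsarteDual.
Variables (F : finFieldType) (L : fieldExtType F) (n m : nat).
Local Notation Z0 := 'M[L]_(m, n).
Implicit Types (C : {vspace Z0}) (x y : resF 'rV[L]_m).

(* On [mooreV], [star] takes its values in [1%VS], where the coordinate is the inverse of [in_alg]. *)
Definition trace_form (u v : subvs_of (mooreV L n m)) : F :=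
  coord [tuple (1 : L)] ord0 (star (vsval u : Z0) (vsval v : Z0)).

Fact trace_form_bilinear :
  bilinear_for (GRing.Scale.Law.clone _ _ *%R _) (GRing.Scale.Law.clone _ _ *%R _) trace_form.
Proof.
have starl a (u v w : resF Z0) : star (a *: u + v) w = a *: star u w + star v w.
  by rewrite -mulr_algl; apply: (linearPl (@star F L n m) w a%:A u v).
split=> [g|f] a u v; rewrite /trace_form /=; last rewrite ![star (vsval f) _]starC.
  by rewrite starl linearP.
by rewrite starl linearP.
Qed.

HB.instance Definition _ := bilinear_isBilinear.Build F
  (subvs_of (mooreV L n m)) (subvs_of (mooreV L n m)) F _ _ trace_form trace_form_bilinear.

(** Nondegeneracy gives U_G the F-dimension of L^m, so [system_fun G] is injective; its kernel
    consists of the [x] with [moore n x] in C^perp. Hence [mooreV] and C^perp meet trivially, as the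
    Delsarte dual requires. *)
Lemma nondegenerate_moore C x : \dim {:L} = n ->
  nondegenerate_code C -> (moore n x : Z0) \in dual_code C -> x = 0.
Proof.
move=> hn [G bG dG]; rewrite -(lker_star_hom bG) memv_ker -system_funE => /eqP Gx.
have := limg_ker_dim (linfun (system_fun G)) fullv.
rewrite capfv -[limg _]/(system G) dG dim_resF hn dim_fullv_matrix mul1n mulnC.
move/eqP; rewrite -[X in _ == X]add0n eqn_add2r dimv_eq0 => /eqP ker0.
by apply/eqP; rewrite -memv0 -ker0 memv_ker lfunE /= Gx.
Qed.

Lemma lker_system_fun C k (G : k.-tuple Z0) : basis_of C G ->
  (forall x, (moore n x : Z0) \in dual_code C -> x = 0) -> lker (linfun (system_fun G)) == 0%VS.
Proof.
move=> bG C0; rewrite -subv0; apply/subvP => x; rewrite memv0 memv_ker lfunE /= => /eqP Gx.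
apply/eqP/C0; rewrite -(lker_star_hom bG) memv_ker -system_funE; exact/eqP.
Qed.

Lemma dim_system C k (G : k.-tuple Z0) : \dim {:L} = n -> basis_of C G ->
  (forall x, (moore n x : Z0) \in dual_code C -> x = 0) -> \dim (system G) = (n * m)%N.
Proof.
move=> hn bG C0; rewrite limg_dim_eq ?(eqP (lker_system_fun bG C0)) ?capv0 //.
by rewrite dim_resF hn dim_fullv_matrix mul1n mulnC.
Qed.

(** [moore n x] has rank at most 1, below the minimum distance. As C is its own double dual, this is
    for C^perp what [nondegenerate_moore] is for C. *)
Lemma moore_min_distance C d x : \dim {:L} = n -> (0 < n)%N ->
  is_min_distance C d -> (1 < d)%N -> (moore n x : Z0) \in C -> x = 0.
Proof.
move=> hn n_gt0 [_ dC] d1 Cx; apply: (moore_inj n_gt0); rewrite linear0.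
apply/eqP/negPn/negP => x0; have := dC _ Cx x0.
by apply/negP; rewrite -ltnNge; apply: leq_ltn_trans (rk_moore hn x) d1.
Qed.

(** A code equal to the whole space would contain the Moore matrix of the all-one vector. The strict
    inequality is the condition M > k of the Delsarte dual. *)
Lemma dim_code_lt C d : \dim {:L} = n -> (0 < n)%N -> (0 < m)%N ->
  is_min_distance C d -> (1 < d)%N -> (\dim C < n * m)%N.
Proof.
move=> hn n_gt0 m_gt0 dC d1; rewrite mulnC -(dim_fullv_matrix L) ltn_neqAle dimvS ?subvf // andbT.
apply/negP => /eqP dimC; have CT : C = fullv.
  by apply/eqP; rewrite eqEdim subvf dimC leqnn.
have : const_mx 1 = 0 :> 'rV[L]_m.
  by apply: (moore_min_distance hn n_gt0 dC d1); rewrite CT memvf.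
by move/rowP/(_ (Ordinal m_gt0)); rewrite !mxE => /eqP; rewrite oner_eq0.
Qed.

Lemma system_is_Delsarte_dual C k (G : k.-tuple Z0) (G' : (n * m - k).-tuple Z0) :
  \dim {:L} = n -> (0 < n)%N -> basis_of C G -> basis_of (dual_code C) G' ->
  (k < n * m)%N -> (forall x, (moore n x : Z0) \in dual_code C -> x = 0) ->
  is_Delsarte_dual (n * m) (system G) (system G').
Proof.
move=> hn n_gt0 bG bG' lt_k C0.
have dimC : \dim C = k by rewrite -(size_basis bG).
have GT := limg_star_hom (basis_free bG); have G'T := limg_star_hom (basis_free bG').
have kerG : lker (quotv_proj (dual_code C)) = lker (star_hom G).
  by rewrite quotv_proj_ker (lker_star_hom bG).
have kerG' : lker (quotv_proj (perpv (@star F L n m) (dual_code C))) = lker (star_hom G').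
  by rewrite quotv_proj_ker (lker_star_hom bG').
(* [phi] and [psi] are the coordinates on Z0/C^perp and Z0/C in which the projections become
   [star_hom G] and [star_hom G']. *)
have [phi phi_bij phiE] := lfun_factor (quotv_proj_img _) GT kerG.
have [psi psi_bij psiE] := lfun_factor (quotv_proj_img _) G'T kerG'.
have WT := Lspan_mooreV m hn.
have trace_formE (u v : subvs_of (mooreV L n m)) :
    star (vsval u : Z0) (vsval v : Z0) = (trace_form u v)%:A.
  have [x xE] := mooreVP (subvsP u); have [y yE] := mooreVP (subvsP v).
  have := star_moore_mem1 hn x y; rewrite -xE -yE => /vlineP[c cE].
  rewrite /trace_form cE linearZ /=.
  have := coord_free 0 (X := [tuple (1 : L)]) 0.
  by rewrite seq1_free oner_neq0 => ->; rewrite // mulr1.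
have trace_nd (u : subvs_of (mooreV L n m)) :
    (forall v : subvs_of (mooreV L n m), trace_form u v = 0) -> u = 0.
  move=> u0; apply: subvs_inj; rewrite linear0; apply: (star_moore_eq0 hn) => y.
  by rewrite -(vsprojK (mem_mooreV n y)) trace_formE u0 scale0r.
exists Z0 (mooreV L n m) (dual_code C) phi trace_form (@star F L n m) psi => //.
- exact: dim_system hn bG C0.
- by rewrite systemE; apply: Lspan_limg.
- by rewrite dim_fullv_matrix mulnC.
- exact: dim_mooreV.
- by rewrite dim_dual_code dimC mulnC.
- by move=> _ /mooreVP[x ->] /C0->; rewrite linear0.
- rewrite systemE; congr (_ @: _)%VS; apply/lfunP => z.
  by rewrite !resHomE comp_lfunE phiE.
- split=> // v v0; apply: trace_nd => u; rewrite -[RHS](v0 u) /trace_form.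
  by rewrite starC.
- exact: star_nondegenerate.
- rewrite systemE; congr (_ @: _)%VS; apply/lfunP => z.
  by rewrite !resHomE comp_lfunE psiE.
Qed.

Lemma Delsarte_dual_GLequiv C k (G : k.-tuple Z0) (G' : (n * m - k).-tuple Z0) D :
  \dim {:L} = n -> (0 < n)%N -> basis_of C G -> basis_of (dual_code C) G' ->
  (forall x, (moore n x : Z0) \in dual_code C -> x = 0) ->
  is_Delsarte_dual (n * m) (system G) D -> GLequiv (system G') D.
Proof.
move=> hn n_gt0 bG bG' C0 [Z W Gam phi beta' beta psi _ _ _ dimZ dimW WT _ WGam].
move=> phi_bij UE _ betaE [beta_ndl _] psi_bij DE.
pose pr := (phi \o quotv_proj Gam)%VF; pose S := linfun (system_fun G).
pose rho := (psi \o quotv_proj (perpv beta Gam))%VF.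
have S_inj : injective S. by apply/lker0P; apply: lker_system_fun bG C0.
have ker_pr : lker pr = Gam by rewrite lker_comp_bij ?quotv_proj_ker.
have ker_rho : lker rho = perpv beta Gam by rewrite lker_comp_bij ?quotv_proj_ker.
(* On [W], [T] sends [w] to [moore n x] for the unique [x] with [system_fun G x = pr w]; it is then
   extended L-linearly to [Z]. *)
have [T TE] := Lspan_extend (linfun (moore n (m := m)) \o S^-1 \o resHom pr)%VF WT (etrans dimW (esym dimZ)).
have T_W w : w \in W -> exists2 x, T w = moore n x & system_fun G x = pr w.
  move=> Ww; exists ((S^-1)%VF (pr w)).
    by rewrite TE // 2!comp_lfunE resHomE lfunE.
  have : pr w \in limg S by rewrite -[limg S]/(system G) -UE -(resHomE pr); apply: memv_img.
  by move/limg_lfunVK; rewrite {1}lfunE.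
have T_moore x : exists2 w, w \in W & T w = moore n x.
  have : S x \in system G by rewrite memv_img ?memvf.
  rewrite -UE => /memv_imgP[w Ww]; rewrite resHomE => Sx; exists w => //.
  have [y -> Sy] := T_W w Ww; congr moore; apply: S_inj.
  by rewrite Sx lfunE.
have prE z : star_hom G (T z) = pr z.
  rewrite -comp_lfunE; congr (fun_of_lfun _ z); apply: (Lspan_full_eq WT) => w Ww.
  by rewrite comp_lfunE; have [x -> <-] := T_W w Ww; rewrite system_funE.
have T_surj : limg T = fullv.
  apply/eqP; rewrite eqEsubv subvf -(Lspan_mooreV m hn); apply/Lspan_sub => _ /mooreVP[x ->].
  have [w _ <-] := T_moore x; exact: (memv_img T (memvf (w : Z))).
have T_inj : lker T == 0%VS.
  by apply: lker_surj_eq0; rewrite // dimZ dim_fullv_matrix mulnC.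
have T_Gam z : (T z \in dual_code C) = (z \in Gam).
  by rewrite -(lker_star_hom bG) memv_ker prE -memv_ker ker_pr.
(* These entries are forced by testing [star (N z) (T z') = beta z z'] at the [z'] with
   [T z' = delta_mx i j]. *)
pose N0 z : Z0 := \matrix_(i, j) beta z ((T^-1)%VF (delta_mx i j)).
have N0lin : linear N0 by move=> a x y; apply/matrixP=> i j; rewrite !mxE linearPl.
pose N1 : {linear Z -> Z0} := HB.pack N0 (GRing.isLinear.Build L Z Z0 _ N0 N0lin).
pose N := linfun N1.
have NE z z' : star (N z) (T z') = beta z z'.
  rewrite -{2}[z'](lker0_lfunK T_inj) [in RHS](matrix_sum_delta (T z')).
  rewrite linear_sum linear_sumr; apply: eq_bigr => i _.
  rewrite linear_sum linear_sumr; apply: eq_bigr => j _.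
  by rewrite linearZ linearZr /= lfunE /= mxE mulrC.
have N_inj : lker N == 0%VS.
  rewrite -subv0; apply/subvP=> z; rewrite memv_ker memv0 => /eqP Nz.
  by apply/eqP/beta_ndl => z'; rewrite -NE Nz linear0l.
have N_surj : limg N = fullv.
  apply/eqP; rewrite eqEdim subvf limg_dim_eq; last by rewrite (eqP N_inj) capv0.
  by rewrite dimZ dim_fullv_matrix mulnC leqnn.
(* For [w] in [W], [star (N w)] takes values in F on Moore matrices, because [beta] restricts to
   [beta']; self-duality puts [N w] in [mooreV], and the dimensions agree. *)
have N_W : (resHom N @: W)%VS = mooreV L n m.
  apply/eqP; rewrite eqEdim dim_mooreV // limg_dim_eq; last first.
    by rewrite (eqP (lker_resHom0 N_inj)) capv0.
  rewrite dimW leqnn andbT; apply/subvP=> _ /memv_imgP[w Ww ->]; rewrite resHomE.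
  apply: star_mem1_moore => // y; have [w' Ww' <-] := T_moore y.
  rewrite NE -(vsprojK Ww) -(vsprojK Ww') betaE; apply/vlineP.
  by exists (beta' (vsproj W w) (vsproj W w')).
(* Both kernels consist of the [z] with [N z] orthogonal to C^perp, because [T] carries [Gam] onto
   C^perp. *)
have ker_N : lker (star_hom G' \o N) = lker rho.
  apply/vspaceP=> z; rewrite ker_rho memv_ker comp_lfunE -memv_ker (lker_star_hom bG').
  apply/dual_codeP/perpvP => [Nz v Gv|bz g].
    by rewrite -NE Nz // T_Gam.
  by rewrite -(limg_lfunVK (f := T) (x := g)) ?T_surj ?memvf // T_Gam NE => /bz.
have limg_N : limg (star_hom G' \o N) = fullv.
  by rewrite limg_comp N_surj limg_star_hom ?(basis_free bG').
have limg_rho : limg rho = fullv by rewrite limg_comp_bij ?quotv_proj_img.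
(* [h] intertwines the two projections of [Z]; since [N] maps [W] onto [mooreV], it carries U_G'
   onto [D]. *)
have [h h_bij hE] := lfun_factor limg_N limg_rho ker_N.
have [A A_unit AE] := lfun_rV_mulmx h_bij.
exists A => //; rewrite systemE -DE -N_W -!limg_comp; congr (_ @: W)%VS.
apply/lfunP => z; rewrite !comp_lfunE !resHomE [LHS]lfunE /= -AE -hE.
by rewrite comp_lfunE.
Qed.

End DelsarteDual.

Theorem theorem3p6 (F : finFieldType) (L : fieldExtType F) (n m k d : nat)
    (C : {vspace 'M[L]_(m, n)})
    (hn : \dim {:L} = n) (n_gt0 : (0 < n)%N) (m_gt0 : (0 < m)%N) (k_gt0 : (0 < k)%N)
    (C_dim : \dim C = k) (C_nondeg : nondegenerate_code C)
    (C_dist : is_min_distance C d) (d_gt1 : (1 < d)%N)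
    (G : k.-tuple 'M[L]_(m, n)) (G_basis : basis_of C G) :
  \dim (dual_code C) = (n * m - k)%N /\
  forall G' : (n * m - k).-tuple 'M[L]_(m, n), basis_of (dual_code C) G' ->
    (exists D : {vspace resF 'rV[L]_(n * m - k)}, is_Delsarte_dual (n * m) (system G) D) /\
    (forall D : {vspace resF 'rV[L]_(n * m - k)}, is_Delsarte_dual (n * m) (system G) D ->
       \dim D = (n * m)%N /\ GLequiv (system G') D).
Proof.
have C0 x : (moore n x : 'M[L]_(m, n)) \in dual_code C -> x = 0 by apply: nondegenerate_moore.
split=> [|G' bG']; first by rewrite dim_dual_code C_dim mulnC.
split=> [|D dualD].
  exists (system G'); apply: (system_is_Delsarte_dual hn n_gt0 G_basis bG' _ C0).
  by rewrite -C_dim (dim_code_lt hn n_gt0 m_gt0 C_dist d_gt1).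
have equivD := Delsarte_dual_GLequiv hn n_gt0 G_basis bG' C0 dualD.
(* The dimension of [D] is that of U_G', which is nm because C is the dual of C^perp and contains no
   nonzero Moore matrix. *)
split=> //; rewrite (dim_GLequiv equivD) (dim_system hn bG') // => x.
by rewrite dual_codeK; apply: moore_min_distance hn n_gt0 C_dist d_gt1.
Qed.
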